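(* Let $k\geq 1$ and let $X\subset\mathbb{P}\,\mathrm{Sym}^2\mathbb{R}^{k+1}$ be the set of real symmetric $(k+1)\times(k+1)$-matrices (up to scaling) with an eigenvalue of multiplicity $\ge k$. Then the Zariski closure of $X$ in $\mathbb{P}\,\mathrm{Sym}^2\mathbb{C}^{k+1}$ is projectively equivalent to the projective cone over the coordinate-wise square $L^{\circ2}$ of any $k$-dimensional linear space $L$ (in a complex projective space $\mathbb{P}^n$) whose point configuration $Z\subset\mathbb{P}W^*$ lies on a unique and smooth quadric.
   Context: For $\mathbb{F}=\mathbb{R}$ or $\mathbb{C}$, $\mathbb{P}\,\mathrm{Sym}^2\mathbb{F}^{k+1}$ is the projective space of non-zero symmetric $(k+1)\times(k+1)$-matrices over $\mathbb{F}$ up to scaling. $L^{\circ2}$ denotes the coordinate-wise square of $L$: the image of $L$ under $\varphi_2\colon\mathbb{P}^n\to\mathbb{P}^n$, $[x_0:\ldots:x_n]\mapsto[x_0^2:\ldots:x_n^2]$. A $k$-dimensional linear space $L\subset\mathbb{P}^n$ is viewed as the image of a chosen linear embedding $[\ell_0:\ldots:\ell_n]\colon\mathbb{P}W\hookrightarrow\mathbb{P}^n$, where $W$ is a $(k+1)$-dimensional complex vector space and $\ell_0,\ldots,\ell_n\in W^*$ are linear forms; its point configuration is the finite set $Z:=\{[\ell_i]\in\mathbb{P}W^*\mid 0\le i\le n,\ \ell_i\ne0\}$. ''$Z$ lies on a unique and smooth quadric'' means that the space $I(Z)_2\subset\mathrm{Sym}^2W$ of quadratic forms on $W^*$ vanishing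 on $Z$ is one-dimensional, spanned by a quadratic form of full rank $k+1$. Projective equivalence is understood up to linear re-embedding: $L^{\circ2}$ is regarded as a subvariety of its linear span, the cone over it is formed from a single vertex point outside that span, and this cone is compared with the closure of $X$ up to a linear isomorphism of the ambient projective spaces. *)

(* Defs.v *)
From mathcomp Require Import all_boot all_order all_algebra.
From mathcomp Require Import boolp classical_sets reals.
From mathcomp Require Import complex.
From mathcomp Require Import mpoly.

Set Implicit Arguments.
Unset Strict Implicit.
Unset Printing Implicit Defensive.

Import Order.TTheory GRing.Theory Num.Theory.
Local Open Scope classical_set_scope.
Local Open Scope ring_scope.

(* Points of P(V) are the lines through 0 in V.  Accordingly, p = [v] is
   written [val p = <[v]>%VS], which already forces v != 0. *)
Definition proj (K : fieldType) (V : vectType K) : Type :=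
  {U : {vspace V} | \dim U == 1%N}.

Definition dual (K : fieldType) (V : vectType K) : vectType K := 'Hom(V, K^o).

Section Projective.
Variable K : fieldType.

Definition is_linspan (V : vectType K) (Y : set (proj V)) (S : {vspace V}) :=
  (forall p, Y p -> (val p <= S)%VS) /\
  (forall S' : {vspace V}, (forall p, Y p -> (val p <= S')%VS) -> (S <= S')%VS).

(* The affine cone over the projective linear span of Y; the default value is
   never used, see linspanP. *)
Definition linspan (V : vectType K) (Y : set (proj V)) : {vspace V} :=
  xget fullv [set S | is_linspan Y S].

Lemma linspanP (V : vectType K) (Y : set (proj V)) : is_linspan Y (linspan Y).
Proof.
suff [S SP] : exists S, is_linspan Y S by exact: (xgetPex fullv (ex_intro _ S SP)).
pose Q (S : {vspace V}) := forall p, Y p -> (val p <= S)%VS.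
have exQ : exists d, `[< exists2 S, Q S & \dim S = d >].
  by exists (\dim {:V}); apply/asboolP; exists fullv => // p _; apply: subvf.
case: (ex_minnP exQ) => d /asboolP [S QS dS] mind.
exists S; split=> // S' QS'.
have QI : Q (S :&: S')%VS by move=> p Yp; rewrite subv_cap QS ?QS'.
have : (d <= \dim (S :&: S'))%N by apply: mind; apply/asboolP; exists (S :&: S')%VS.
rewrite -dS => le; have /eqP <- : (S :&: S')%VS == S by rewrite eqEdim capvSl.
exact: capvSr.
Qed.

(* Y regarded as a subset of the projectivization of its linear span. *)
Definition in_linspan (V : vectType K) (Y : set (proj V)) :
    set (proj (subvs_of (linspan Y))) :=
  [set p | exists q v, [/\ Y q, val p = <[v]>%VS & val q = <[vsval v]>%VS]].

(* The union of the lines joining the vertex [0 : 1] of P(V (+) K), which lies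
   outside P(V) = P(V (+) 0), to the points of Y. *)
Definition pcone (V : vectType K) (Y : set (proj V)) : set (proj (V * K^o)%type) :=
  [set q | exists p v t, [/\ Y p, v \in val p & val q = <[((v, t) : V * K^o)]>%VS]].

Definition proj_equiv (V V' : vectType K) (Y : set (proj V)) (Y' : set (proj V')) :=
  exists f : 'Hom(V, V'), [/\ lker f = 0%VS, limg f = fullv
    & Y' = [set q | exists2 p, Y p & val q = (f @: val p)%VS]].

Definition vanishes_at (V : vectType K) (f : {mpoly K[\dim {:V}]}) (p : proj V) :=
  forall v, v \in val p -> f.@[fun i => coord (vbasis {:V}) i v] = 0.

Definition zclosure (V : vectType K) (Y : set (proj V)) : set (proj V) :=
  [set p | forall (d : nat) (f : {mpoly K[\dim {:V}]}), f \is d.-homog ->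
     (forall q, Y q -> vanishes_at f q) -> vanishes_at f p].

Definition csquare (n : nat) (Y : set (proj 'rV[K]_n)) : set (proj 'rV[K]_n) :=
  [set q | exists p v, [/\ Y p, val p = <[v]>%VS
     & val q = <[map_mx (fun x => x ^+ 2) v]>%VS]].

Definition linear_embedding (W : vectType K) (n : nat) (ell : 'I_n.+1 -> dual W) :=
  forall w : W, (forall i, ell i w = 0) -> w = 0.

Definition embedded_space (W : vectType K) (n : nat) (ell : 'I_n.+1 -> dual W) :
    set (proj 'rV[K]_n.+1) :=
  [set p | exists w : W, val p = <[\row_i (ell i w : K)]>%VS].

(* [val p = <[ell i]>] discards the indices i with ell i = 0. *)
Definition point_config (W : vectType K) (n : nat) (ell : 'I_n.+1 -> dual W) :
    set (proj (dual W)) :=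
  [set p | exists i, val p = <[ell i]>%VS].

End Projective.
Arguments in_linspan [K V] Y _.

Section Quadrics.
(* Quadratic forms on V are given by their symmetric bilinear forms b, the
   value at v being b v v; this is Sym^2 V^* because the characteristic is 0. *)
Variables (K : numFieldType) (V : vectType K).

Definition bilform : vectType K := 'Hom(V, dual V).

Definition bval (b : bilform) (u v : V) : K := (b u : 'Hom(V, K^o)) v.

Definition symform (b : bilform) := forall u v, bval b u v = bval b v u.

Definition form_rank (b : bilform) : nat := \dim (limg b).

(* I(Z)_2 *)
Definition quadrics_through (Z : set (proj V)) : set bilform :=
  [set b | symform b /\ forall p, Z p -> forall v, v \in val p -> bval b v v = 0].

Definition on_unique_smooth_quadric (Z : set (proj V)) :=
  exists b : bilform,
    [/\ forall b', quadrics_through Z b' <-> b' \in <[b]>%VS,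
        \dim <[b]>%VS = 1%N
      & form_rank b = \dim {:V}].

End Quadrics.

Section SymmetricMatrices.

Definition symmx (K : fieldType) (m : nat) : {vspace 'M[K]_m} :=
  fixedSpace (linfun (@trmx K m m)).

Lemma symmxP (K : fieldType) (m : nat) (A : 'M[K]_m) :
  reflect (A^T = A) (A \in symmx K m).
Proof. by apply: (iffP fixedSpaceP); rewrite lfunE. Qed.

Definition Sym (K : fieldType) (m : nat) : vectType K := subvs_of (symmx K m).

Definition symval (K : fieldType) (m : nat) (A : Sym K m) : 'M[K]_m :=
  vsval (A : subvs_of (symmx K m)).

Definition mult_eigen_locus (K : fieldType) (k : nat) : set (proj (Sym K k.+1)) :=
  [set p | exists A : Sym K k.+1, val p = <[A]>%VS /\
     exists a : K, eigenvalue (symval A) a /\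
       (k <= mup a (char_poly (symval A)))%N].

(* The image of a set of real points under P(Sym^2 R^m) -> P(Sym^2 C^m). *)
Definition complexify (R : realType) (m : nat) (X : set (proj (Sym R m))) :
    set (proj (Sym R[i] m)) :=
  [set q | exists p A B, [/\ X p, val p = <[A]>%VS, val q = <[B]>%VS
     & symval B = map_mx (real_complex R) (symval A)]].

End SymmetricMatrices.
Arguments mult_eigen_locus : clear implicits.

(* Main.v *)
Require Import Defs.
From HB Require Import structures.
From mathcomp Require Import all_boot all_order all_algebra.
From mathcomp Require Import boolp classical_sets reals.
From mathcomp Require Import complex.
From mathcomp Require Import mpoly.
From mathcomp Require Import ring spectral sesquilinear.

Set Implicit Arguments.
Unset Strict Implicit.
Unset Printing Implicit Defensive.

Import Order.TTheory GRing.Theory Num.Theory.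
Local Open Scope ring_scope.

(* Put m = k + 1.  A real symmetric matrix has an eigenvalue of multiplicity >= k
   exactly when it is a scalar matrix plus one of rank <= 1, and the Zariski
   closure of this locus is the set of all [a I + w^T w] over the complex numbers:
   that this set is closed follows by eliminating [a] from the 2x2 minors of
   [A - a I] with resultants.
   On the other side, [w^T w |-> (ell_i(w)^2)_i] extends to a linear map on
   symmetric matrices whose kernel is I(Z)_2, hence spanned by a nondegenerate
   form, which becomes the identity matrix I in suitable coordinates of W.  Its
   image is the span of the coordinate-wise square, so pairing this map with the
   trace, which does not kill I, gives an isomorphism that sends [I] to the vertex
   and [a I + w^T w] to the cone over the square. *)

(** * Homogeneous polynomial functions on a vector space *)

Section HomogeneousFunctions.
Variables (K : fieldType) (V : vectType K).

(** Phrased for functions rather than polynomials, so that coordinate-free expressions, such as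
    products of matrix entries, can be tested against [zclosure], whose polynomials are in the
    coordinates of [vbasis]. *)
Definition homog_fun (d : nat) (f : V -> K) :=
  exists2 P : {mpoly K[\dim {:V}]}, P \is d.-homog &
    forall v, f v = P.@[fun i => coord (vbasis {:V}) i v].

Lemma homog_funD d f g : homog_fun d f -> homog_fun d g -> homog_fun d (fun v => f v + g v).
Proof.
move=> [P Pd fP] [Q Qd gQ]; exists (P + Q); first exact: rpredD.
by move=> v; rewrite mevalD fP gQ.
Qed.

Lemma homog_funZ d c f : homog_fun d f -> homog_fun d (fun v => c * f v).
Proof.
by move=> [P Pd fP]; exists (c *: P) => [|v]; rewrite ?rpredZ// mevalZ fP.
Qed.

Lemma homog_funM d e f g : homog_fun d f -> homog_fun e g -> homog_fun (d + e) (fun v => f v * g v).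
Proof.
move=> [P Pd fP] [Q Qd gQ]; exists (P * Q); first exact: dhomogM.
by move=> v; rewrite mevalM fP gQ.
Qed.

Lemma homog_fun_linear (f : V -> K) :
  (forall a u v, f (a *: u + v) = a * f u + f v) -> homog_fun 1 f.
Proof.
move=> f_linear; pose fL := GRing.isLinear.Build _ _ K^o _ f f_linear.
have [g gE] : exists g : {linear V -> K^o}, g =1 f.
  by exists (HB.pack f fL : {linear V -> K^o}).
exists (\sum_(i < \dim {:V}) (g (vbasis {:V})`_i : K) *: 'X_i).
  by apply: rpred_sum => i _; rewrite rpredZ// dhomogX /= mdeg1.
move=> v; rewrite -gE {1}(coord_vbasis (memvf v)) !linear_sum /=.
by apply: eq_bigr => i _; rewrite linearZ /= mevalZ mevalXU mulrC.
Qed.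

Lemma eq_homog_fun d f g : f =1 g -> homog_fun d f -> homog_fun d g.
Proof. by move=> fg [P Pd fP]; exists P => // v; rewrite -fg. Qed.

Lemma homog_funB d (f g : V -> K) : homog_fun d f -> homog_fun d g -> homog_fun d (fun v => f v - g v).
Proof.
move=> hf hg; apply: eq_homog_fun (homog_funD hf (homog_funZ (-1) hg)) => v /=.
by rewrite mulN1r.
Qed.

Lemma zclosure_homog_fun (Y : set (proj V)) (p : proj V) d f :
  homog_fun d f -> zclosure Y p ->
  (forall q, Y q -> forall v, v \in val q -> f v = 0) ->
  forall v, v \in val p -> f v = 0.
Proof.
move=> [P Pd fP] clYp fY v vp; rewrite fP; apply: clYp Pd _ v vp => q Yq u uq.
by rewrite -fP; apply: fY uq.
Qed.

(** Restriction to a polynomial curve: the coordinates of the curve, themselves polynomials in [s],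
    are substituted for the variables. *)
Lemma homog_fun_polyE d f (n : nat) (u : 'I_n -> V) : homog_fun d f ->
  exists Q : {poly K}, forall s, Q.[s] = f (\sum_(j < n) s ^+ j *: u j).
Proof.
move=> [P _ fP].
pose c i : {poly K} := \sum_(j < n) (coord (vbasis {:V}) i (u j)) *: 'X^j.
exists (mmap polyC c P) => s; rewrite fP mevalE /mmap horner_sum.
apply: eq_bigr => m _; rewrite hornerM hornerC /mmap1 horner_prod.
congr (_ * _); apply: eq_bigr => i _; rewrite horner_exp; congr (_ ^+ _).
rewrite /c horner_sum linear_sum; apply: eq_bigr => j _.
by rewrite !hornerE linearZ /= mulrC.
Qed.

End HomogeneousFunctions.

(** In characteristic 0 the first [size p] naturals are distinct, which is one root too many. *)
Lemma poly_natr_eq0 (K : numDomainType) (p : {poly K}) :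
  (forall n : nat, p.[n%:R] = 0) -> p = 0.
Proof.
move=> p0; apply/eqP/contraT => pN0.
have uniq_rs : uniq [seq (i%:R : K) | i <- iota 0 (size p)].
  by rewrite map_inj_uniq ?iota_uniq //; apply: mulrIn; rewrite oner_eq0.
have := max_poly_roots pN0 _ uniq_rs; rewrite size_map size_iota ltnn; apply.
by apply/allP => _ /mapP[i _ ->]; apply/rootP.
Qed.

Lemma vline_proj_proof (K : fieldType) (V : vectType K) (v : V) :
  v != 0 -> \dim <[v]>%VS == 1%N.
Proof. by rewrite dim_vline => ->. Qed.

Lemma proj_lineP (K : fieldType) (V : vectType K) (p : proj V) :
  exists2 v : V, v != 0 & val p = <[v]>%VS.
Proof.
case: p => U /= /[dup] dU /eqP dU1.
have vN0 : vpick U != 0.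
  by rewrite vpick0; apply: contraTneq dU => ->; rewrite dimv0.
exists (vpick U) => //; apply/eqP; rewrite eq_sym eqEdim dim_vline vN0 dU1 andbT.
by rewrite -memvE memv_pick.
Qed.

(** * Elimination of a parameter from a family of quadratic polynomials *)

Section CommonRoots.
Variables (C : numClosedFieldType) (V : vectType C).

(* A family of quadratic polynomials in [t] whose coefficients make [q v t]
   jointly homogeneous of degree 2 in [(v, t)]. *)
Definition hquad (q : V -> C -> C) := exists a b c, [/\ homog_fun 1 b, homog_fun 2 c &
  forall v t, q v t = a * t ^+ 2 + b v * t + c v].

Lemma hquadB q r : hquad q -> hquad r -> hquad (fun v t => q v t - r v t).
Proof.
move=> [a [b [c [hb hc qE]]]] [a' [b' [c' [hb' hc' rE]]]].
exists (a - a'), (fun v => b v - b' v), (fun v => c v - c' v).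
by split=> [||v t]; [apply: homog_funB|apply: homog_funB|rewrite qE rE; ring].
Qed.

Lemma hquad_prod (f g : V -> C) a b : homog_fun 1 f -> homog_fun 1 g ->
  hquad (fun v t => (f v - a * t) * (g v - b * t)).
Proof.
move=> hf hg; exists (a * b), (fun v => (- b) * f v - a * g v), (fun v => f v * g v).
split=> [||v t]; last by ring.
- by apply: homog_funB; apply: homog_funZ.
- exact: (homog_funM hf hg).
Qed.

(** Division of [q v] by the monic polynomial with coefficients [b v] and [c v] leaves the remainder
    [r1 v * t + r0 v]. The product of its values at the two roots is symmetric in them, hence a form
    in [v], of degree 4. *)
Lemma hquad_resultant q (b c : V -> C) : hquad q -> homog_fun 1 b -> homog_fun 2 c ->
  exists2 f, homog_fun 4 f & forall v x y,
    b v = - (x + y) -> c v = x * y -> f v = q v x * q v y.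
Proof.
move=> [a' [b' [c' [hb' hc' qE]]]] hb hc.
pose r1 v := b' v - a' * b v; pose r0 v := c' v - a' * c v.
have hr1 : homog_fun 1 r1 by apply: homog_funB => //; apply: homog_funZ.
have hr0 : homog_fun 2 r0 by apply: homog_funB => //; apply: homog_funZ.
exists (fun v => r1 v * r1 v * c v - r1 v * r0 v * b v + r0 v * r0 v).
  apply: homog_funD; last exact: (homog_funM hr0 hr0).
  apply: homog_funB; first exact: (homog_funM (homog_funM hr1 hr1) hc).
  exact: (homog_funM (homog_funM hr1 hr0) hb).
by move=> v x y bv cv; rewrite !qE /r1 /r0 bv cv; ring.
Qed.

Lemma quadratic_roots (b c : C) : exists x y, b = - (x + y) /\ c = x * y.
Proof.
pose d := sqrtC (b ^+ 2 - 4%:R * c).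
have d2 : d ^+ 2 = b ^+ 2 - 4%:R * c by rewrite sqrtCK.
exists ((- b + d) / 2%:R), ((- b - d) / 2%:R); split; first by field.
rewrite mulrACA -invfM [X in X / _](_ : _ = b ^+ 2 - d ^+ 2); last by ring.
by rewrite d2; field.
Qed.

(* [r v x * r v y] is the resultant of [r v] with the monic [q i0 v], whose roots
   are [x] and [y].  It vanishes on the closure for every [r] in the span of the
   [q i]; if neither root were common to all [q i], some difference [q i - q j]
   would have nonzero resultant. *)
Lemma zclosure_common_root (I : Type) (i0 : I) (q : I -> V -> C -> C)
    (b c : V -> C) (Y : set (proj V)) (p : proj V) :
  (forall i, hquad (q i)) -> homog_fun 1 b -> homog_fun 2 c ->
  (forall v t, q i0 v t = t ^+ 2 + b v * t + c v) ->
  (forall y, Y y -> forall v, v \in val y -> exists t, forall i, q i v t = 0) ->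
  zclosure Y p -> forall v, v \in val p -> exists t, forall i, q i v t = 0.
Proof.
move=> hq hb hc q0E Yroot pY v vp.
have [x [y [bv cv]]] := quadratic_roots (b v) (c v).
have prod0 r : hquad r ->
    (forall u t, (forall i, q i u t = 0) -> r u t = 0) -> r v x * r v y = 0.
  move=> hr r0; have [f hf fE] := hquad_resultant hr hb hc.
  rewrite -(fE v x y)//; apply: (zclosure_homog_fun hf pY) vp => z Yz u uz.
  have [t tP] := Yroot z Yz u uz; have [s [s' [bu cu]]] := quadratic_roots (b u) (c u).
  have : (t - s) * (t - s') = 0 by rewrite -[RHS](tP i0) q0E bu cu; ring.
  rewrite (fE u s s')// => /eqP; rewrite mulf_eq0 !subr_eq0 => /orP[]/eqP <-.
    by rewrite (r0 u t)// mul0r.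
  by rewrite (r0 u t)// mulr0.
have [xP|/existsNP[i /eqP qix]] := pselect (forall i, q i v x = 0); first by exists x.
have [yP|/existsNP[j /eqP qjy]] := pselect (forall i, q i v y = 0); first by exists y.
have /eqP := prod0 _ (hq i) (fun _ _ h => h i); rewrite mulf_eq0 (negPf qix) /= => /eqP qiy.
have /eqP := prod0 _ (hq j) (fun _ _ h => h j); rewrite mulf_eq0 (negPf qjy) orbF => /eqP qjx.
have diff0 u t : (forall l, q l u t = 0) -> q i u t - q j u t = 0.
  by move=> h; rewrite !h subrr.
have /eqP := prod0 _ (hquadB (hq i) (hq j)) diff0.
by rewrite qiy qjx subr0 sub0r mulrN oppr_eq0 mulf_eq0 (negPf qix) (negPf qjy).
Qed.

End CommonRoots.

(** * Eigenvalue multiplicity, rank at most one, and squares of row vectors *)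

Lemma rank_le1_minor (K : fieldType) m n (B : 'M[K]_(m, n)) :
  (\rank B <= 1)%N -> forall i i' j j', B i j * B i' j' = B i j' * B i' j.
Proof.
have := mulmx_base B; move: (row_base B) (col_base B).
case: (\rank B) => [|[|//]] u c <- _ i i' j j'; rewrite !mxE.
  by rewrite !big_ord0 !mul0r.
by rewrite !big_ord1; ring.
Qed.

Lemma char_poly_conj (K : fieldType) n (P A : 'M[K]_n) :
  P \in unitmx -> char_poly (invmx P *m A *m P) = char_poly A.
Proof.
move=> Pu; apply: (@mulfI _ (\det P)%:P); first by rewrite polyC_eq0 -unitfE -unitmxE.
rewrite -det_map_mx -det_mulmx [RHS]mulrC -det_mulmx /char_poly_mx.
rewrite mulmxBr mulmxBl scalar_mxC -!map_mxM /=.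
by rewrite -mulmxA mulKVmx.
Qed.

(** Both sides say that at most one diagonal entry differs from [a]: the multiplicity counts the
    entries equal to [a], the rank counts the others. *)
Lemma mup_char_poly_diag (K : fieldType) k (d : 'rV[K]_k.+1) a :
  (k <= mup a (char_poly (diag_mx d)))%N = (\rank (diag_mx d - a%:M)%R <= 1)%N.
Proof.
have -> : char_poly (diag_mx d) = \prod_(y <- [seq d 0 i | i <- enum 'I_k.+1]) ('X - y%:P).
  rewrite char_poly_trig ?diag_mx_is_trig// big_map big_enum /=.
  by apply: eq_bigr => i _; rewrite mxE eqxx.
rewrite mu_prod_XsubC count_map; pose E := [pred i | d 0 i == a].
have -> : count (preim (d 0) (pred1 a)) (enum 'I_k.+1) = #|E|.
  by rewrite -size_filter cardE enumT.
have := cardC E; rewrite card_ord => card_d.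
have -> : (k <= #|E|)%N = (#|predC E| <= 1)%N.
  by rewrite -(leq_add2l #|E| _ 1) card_d addn1 ltnS.
apply/idP/idP => [/card_le1_eqP dP|rk1].
  (* [i0] is the exceptional index, or 0 if every diagonal entry equals [a]. *)
  have [i0 di0] : exists i0, forall i, i != i0 -> d 0 i = a.
    case: (pickP (predC E)) => [i0 /= di0|da]; last first.
      by exists 0 => i _; apply/eqP; have /negbFE := da i.
    exists i0 => i; apply: contraNeq => di; apply/eqP/dP => //.
  suff -> : diag_mx d - a%:M = col i0 (diag_mx d - a%:M) *m delta_mx 0 i0.
    by rewrite (leq_trans (mxrankM_maxr _ _)) ?rank_leq_row.
  apply/matrixP => i j; rewrite !mxE big_ord1 !mxE eqxx /=.
  have [->|/di0 da] := eqVneq j i0; first by rewrite mulr1.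
  rewrite mulr0; case: eqVneq => [->|_]; by rewrite ?mulr1n ?mulr0n ?da ?subrr.
apply/card_le1_eqP => i j; rewrite !inE => di dj; apply/eqP.
(* For distinct [i] and [j] this principal minor is the product of two diagonal entries. *)
have := rank_le1_minor rk1 i j i j; rewrite !mxE !eqxx.
case: eqVneq => // ij /eqP; rewrite eq_sym in ij; rewrite !mulr1n !mulr0n subrr mul0r.
by rewrite mulf_eq0 !subr_eq0 (negPf di) (negPf dj).
Qed.

Lemma mup_char_poly_normal (C : numClosedFieldType) k (A : 'M[C]_k.+1) a :
  A \is normalmx ->
  (k <= mup a (char_poly A))%N = (\rank (A - a%:M)%R <= 1)%N.
Proof.
move=> /orthomx_spectralP ->; set P := spectralmx A; set d := spectral_diag A.
have Pu : P \in unitmx by apply: spectral_unit.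
rewrite char_poly_conj// mup_char_poly_diag.
have -> : invmx P *m diag_mx d *m P - a%:M = invmx P *m (diag_mx d - a%:M) *m P.
  by rewrite mulmxBr mulmxBl scalar_mxC mulmxKV.
by rewrite -mulmxA (eqmxMfull _ (_ : row_full (invmx P)))
  ?row_full_unit ?unitmx_inv// mxrankMfree ?row_free_unit.
Qed.

Lemma mup_map_poly (F K : fieldType) (f : {rmorphism F -> K}) a (p : {poly F}) :
  p != 0 -> mup (f a) (map_poly f p) = mup a p.
Proof.
move=> p0; have fp0 : map_poly f p != 0 by rewrite map_poly_eq0.
have geq n : (n <= mup (f a) (map_poly f p))%N = (n <= mup a p)%N.
  rewrite !mup_geq// -(dvdp_map f) rmorphXn /= rmorphB /=.
  by rewrite map_polyX map_polyC.
by apply/eqP; rewrite eqn_leq geq -geq !leqnn.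
Qed.

(** Over the complex numbers a real symmetric matrix is normal, hence diagonalizable. For complex
    symmetric matrices the equivalence can fail, since these may have nontrivial Jordan blocks. *)
Lemma mup_char_poly_realsym (R : rcfType) k (A : 'M[R]_k.+1) a : A^T = A ->
  (k <= mup a (char_poly A))%N = (\rank (A - a%:M)%R <= 1)%N.
Proof.
move=> Asym; pose f := real_complex R.
rewrite -(mup_map_poly f) ?monic_neq0 ?char_poly_monic// map_char_poly.
have Af_normal : map_mx f A \is normalmx.
  apply: hermitian_normalmx; apply: realsym_hermsym.
    by apply/is_hermitianmxP; rewrite expr0 scale1r map_mx_id// map_trmx Asym.
  by apply/mxOverP => i j; rewrite mxE complex_real.
rewrite mup_char_poly_normal//= -(map_scalar_mx f) -map_mxB.
by rewrite mxrank_map.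
Qed.

(** If some [B i i] is nonzero, row [i] divided by its square root works, because
    [B i j * B i l = B i i * B j l]. Otherwise [B i j ^+ 2 = B i i * B j j = 0] for all entries. *)
Lemma minor_sym_square (C : numClosedFieldType) n (B : 'M[C]_n) : B^T = B ->
  (forall i i' j j', B i j * B i' j' = B i j' * B i' j) ->
  exists w : 'rV_n, B = w^T *m w.
Proof.
move=> /matrixP Bsym minor.
have {}Bsym i j : B i j = B j i by rewrite -[LHS]Bsym mxE.
have [i /= Bi|B0] := pickP (fun i => B i i != 0); last first.
  exists 0; apply/matrixP => i j; rewrite mulmx0 mxE; apply/eqP.
  rewrite -sqrf_eq0 expr2 {2}Bsym (minor i j j i).
  by have /negbFE/eqP -> := B0 i; rewrite mul0r.
exists (\row_j (B i j / sqrtC (B i i))); apply/matrixP => j l.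
rewrite !mxE big_ord1 !mxE mulrACA -invfM -expr2 sqrtCK.
rewrite [B i j]Bsym (minor j i i l) Bsym.
by rewrite [B l j]Bsym mulfK.
Qed.

(** A linear projection defined on all matrices; it inverts [symval] on the symmetric ones only. *)
Definition mxsym (K : fieldType) m (A : 'M[K]_m) : Sym K m := vsproj (symmx K m) A.

Lemma mxsymK (K : fieldType) m (A : 'M[K]_m) : A^T = A -> symval (mxsym A) = A.
Proof. by move=> /symmxP As; apply: vsprojK. Qed.

Lemma symvalK (K : fieldType) m : cancel (@symval K m) (@mxsym K m).
Proof. exact: vsvalK. Qed.

Lemma symval_sym (K : fieldType) m (A : Sym K m) : (symval A)^T = symval A.
Proof. by apply/symmxP; apply: subvsP. Qed.

Lemma symvalZ (K : fieldType) m a (A : Sym K m) : symval (a *: A) = a *: symval A.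
Proof. by rewrite /symval linearZ. Qed.

Lemma symvalP (K : fieldType) m a (A B : Sym K m) :
  symval (a *: A + B) = a *: symval A + symval B.
Proof. by rewrite /symval linearP. Qed.

Lemma symvalD (K : fieldType) m (A B : Sym K m) :
  symval (A + B) = symval A + symval B.
Proof. by rewrite /symval linearD. Qed.

Lemma symval0 (K : fieldType) m : symval (0 : Sym K m) = 0.
Proof. by rewrite /symval linear0. Qed.

Lemma trmx_scalar_add_square (K : fieldType) m a (w : 'rV[K]_m) :
  (a%:M + w^T *m w)^T = a%:M + w^T *m w.
Proof. by rewrite linearD /= tr_scalar_mx trmx_mul trmxK. Qed.

(** * The Zariski closure of the eigenvalue locus *)

Section Closure.
Variables (R : realType) (k : nat).
Hypothesis hk : (1 <= k)%N.
Local Notation C := R[i].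
Local Notation XC := (complexify (mult_eigen_locus R k)).

Lemma map_complexify_locus (a : R) (w : 'rV[R]_k.+1) (B : Sym C k.+1) :
  symval B = map_mx (real_complex R) (a%:M + w^T *m w) -> B != 0 ->
  exists2 q, XC q & val q = <[B]>%VS.
Proof.
set M := _ + _ => BM B0; have Msym : M^T = M by exact: trmx_scalar_add_square.
have M0 : mxsym M != 0.
  apply: contraNneq B0 => M0; rewrite -[B]symvalK BM -(mxsymK Msym) M0.
  by rewrite symval0 map_mx0 /mxsym linear0.
exists (exist _ <[B]>%VS (vline_proj_proof B0)) => //.
exists (exist _ <[mxsym M]>%VS (vline_proj_proof M0)), (mxsym M), B.
split=> //; last by rewrite mxsymK.
exists (mxsym M); split=> //; exists a; rewrite mxsymK//.
have mup_a : (k <= mup a (char_poly M))%N.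
  rewrite mup_char_poly_realsym// addrC addKr.
  by rewrite (leq_trans (mxrankM_maxr _ _)) ?rank_leq_row.
(* As [k] is positive, multiplicity at least [k] makes [a] a root. *)
split=> //; rewrite eigenvalue_root_char -dvdp_XsubCl XsubC_dvd.
  exact: leq_trans mup_a.
exact/monic_neq0/char_poly_monic.
Qed.

(* Write [a = a1 + i a2], [w = u1 + i u2].  On the curve
   [s |-> (a1 + s a2) I + (u1 + s u2)^T (u1 + s u2)], [f] restricts to a
   polynomial in [s] that vanishes at all natural numbers, hence at [s = i]. *)
Lemma homog_fun_locus_eq0 d (f : Sym C k.+1 -> C) : homog_fun d f ->
  (forall q, XC q -> forall v, v \in val q -> f v = 0) ->
  forall (a : C) (w : 'rV[C]_k.+1), f (mxsym (a%:M + w^T *m w)) = 0.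
Proof.
move=> hf fX a w; pose toC := real_complex R.
have I0 : mxsym (1%:M : 'M[C]_k.+1) != 0.
  apply/eqP => /(congr1 (@symval _ _)); rewrite symval0 mxsymK ?trmx1//.
  by move/matrixP/(_ 0 0); rewrite !mxE /= => /eqP; rewrite oner_eq0.
(* The zero matrix spans no point of the locus; the value there is read off on the line through the
   identity matrix. *)
have f0 : f 0 = 0.
  have [|q Xq _] := @map_complexify_locus 1 0 (mxsym 1%:M) _ I0.
    by rewrite mulmx0 addr0 mxsymK ?trmx1// map_mx1.
  by apply: fX Xq _ (mem0v _).
have freal (b : R) (u : 'rV[R]_k.+1) :
    f (mxsym ((toC b)%:M + (map_mx toC u)^T *m map_mx toC u)) = 0.
  set B := mxsym _; have [->//|B0] := eqVneq B 0.
  have [|q Xq qB] := @map_complexify_locus b u B _ B0.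
    rewrite /B mxsymK ?trmx_scalar_add_square// map_mxD map_scalar_mx.
    by rewrite map_mxM map_trmx.
  by apply: fX Xq _ _; rewrite qB memv_line.
pose u1 := map_mx (fun z => toC (complex.Re z)) w.
pose u2 := map_mx (fun z => toC (complex.Im z)) w.
pose a1 := toC (complex.Re a); pose a2 := toC (complex.Im a).
pose curve (s : C) : 'M_k.+1 := (a1 + s * a2)%:M + (u1 + s *: u2)^T *m (u1 + s *: u2).
(* The coefficients of [curve s] in powers of [s]. *)
pose M (j : 'I_3) : 'M[C]_k.+1 := nth 0 [:: a1%:M + u1^T *m u1;
  a2%:M + u1^T *m u2 + u2^T *m u1; u2^T *m u2] j.
have [Q QE] := homog_fun_polyE (fun j => mxsym (M j)) hf.
have QE' s : Q.[s] = f (mxsym (curve s)).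
  rewrite QE; congr f; under eq_bigr do rewrite /mxsym -linearZ.
  rewrite -linear_sum; congr (vsproj _ _); apply/matrixP => i j.
  rewrite !big_ord_recl big_ord0 /= /M /= !mxE !big_ord1 !mxE.
  by case: eqP => _; rewrite ?mulr1n ?mulr0n; ring.
have Q0 : Q = 0.
  apply: poly_natr_eq0 => n; rewrite QE' /curve.
  have -> : u1 + n%:R *: u2 =
      map_mx toC (map_mx (@complex.Re R) w + n%:R *: map_mx (@complex.Im R) w).
    by apply/matrixP => i j; rewrite !mxE /toC rmorphD rmorphM rmorph_nat.
  have -> : a1 + n%:R * a2 = toC (complex.Re a + n%:R * complex.Im a).
    by rewrite /toC rmorphD rmorphM rmorph_nat.
  exact: freal.
have -> : a = a1 + Complex 0 1 * a2 by apply: complexE.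
have -> : w = u1 + Complex 0 1 *: u2.
  by apply/matrixP => i j; rewrite !mxE; apply: complexE.
by rewrite -QE' Q0 horner0.
Qed.

(** From right to left, a form vanishing on the real locus vanishes at all complex parameters. From
    left to right, the 2x2 minors of [symval v - t%:M] are quadratic in [t], and a common root
    persists on the closure. *)
Lemma zclosure_locus (p : proj (Sym C k.+1)) : zclosure XC p <->
  exists A a (w : 'rV_k.+1), val p = <[A]>%VS /\ symval A = a%:M + w^T *m w.
Proof.
split=> [clp|[A [a [w [pA AE]]]] d P Pd PX v]; last first.
  rewrite pA => /vlineP[t ->].
  pose f (v : Sym C k.+1) := P.@[fun i => coord (vbasis {: Sym C k.+1}) i v].
  have hf : homog_fun d f by exists P.
  (* The scalar [t] is absorbed into [w] through its square root, so the family is stable under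
     scaling. *)
  have -> : t *: A = mxsym ((t * a)%:M + (sqrtC t *: w)^T *m (sqrtC t *: w)).
    rewrite -[LHS]symvalK symvalZ AE; congr mxsym.
    apply/matrixP => i j; rewrite !mxE !big_ord1 !mxE mulrDr mulrnAr mulrACA.
    by rewrite -expr2 sqrtCK.
  exact: (homog_fun_locus_eq0 hf).
have [A A0 pA] := proj_lineP p.
pose I := ('I_k.+1 * 'I_k.+1 * ('I_k.+1 * 'I_k.+1))%type.
pose E (v : Sym C k.+1) (t : C) i j : C := symval v i j - (i == j)%:R * t.
pose q (l : I) (v : Sym C k.+1) (t : C) : C := E v t l.1.1 l.2.1 * E v t l.1.2 l.2.2
  - E v t l.1.1 l.2.2 * E v t l.1.2 l.2.1.
have hent i j : homog_fun 1 (fun v : Sym C k.+1 => symval v i j).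
  by apply: homog_fun_linear => a u v; rewrite symvalP !mxE.
have EE v t i j : E v t i j = (symval v - t%:M) i j.
  by rewrite !mxE /E mulr_natl.
have qP v t : (forall l, q l v t = 0) <-> (\rank (symval v - t%:M)%R <= 1)%N.
  split=> [q0|rk1 l]; last first.
    by rewrite /q !EE (rank_le1_minor rk1 l.1.1 l.1.2) subrr.
  have [||w ->] := @minor_sym_square _ _ (symval v - t%:M).
  - by rewrite linearB /= symval_sym tr_scalar_mx.
  - by move=> i i' j j'; rewrite -!EE; apply/subr0_eq/(q0 (i, i', (j, j'))).
  - by rewrite (leq_trans (mxrankM_maxr _ _)) ?rank_leq_row.
have hq l : hquad (q l) by apply: hquadB; apply: hquad_prod.
pose c (v : Sym C k.+1) : C := symval v ord0 ord0 * symval v ord_max ord_max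
  - symval v ord0 ord_max * symval v ord_max ord0.
have hc : homog_fun 2 c.
  by apply: homog_funB; [apply: (homog_funM (hent _ _) (hent _ _))..].
pose b (v : Sym C k.+1) : C := (-1) * (symval v ord0 ord0 + symval v ord_max ord_max).
have hb : homog_fun 1 b by apply: homog_funZ; apply: homog_funD.
(* The principal minor on the first and last indices, which differ because [k] is positive, is monic
   in [t]. *)
have q0E v t : q (ord0, ord_max, (ord0, ord_max)) v t = t ^+ 2 + b v * t + c v.
  have neq : (ord0 == ord_max :> 'I_k.+1) = false.
    by apply/eqP => /(congr1 val) /= k0; move: hk; rewrite -k0.
  have neq' : (ord_max == ord0 :> 'I_k.+1) = false by rewrite eq_sym.
  by rewrite /q /E /= !eqxx neq neq' /b /c /=; ring.
have [||t tP] := zclosure_common_root hq hb hc q0E _ clp (v := A).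
- move=> _ [p' [A1 [B [[A2 [p'A2 [a [_ mup_a]]]] p'A1 -> BA1]]]] v /vlineP[s ->].
  move: mup_a; rewrite mup_char_poly_realsym ?symval_sym// => rk1.
  have /vlineP[r A1r] : A1 \in <[A2]>%VS by rewrite -p'A2 p'A1 memv_line.
  (* The eigenvalue [a] belongs to [A2]; it is rescaled along [A1 = r *: A2] and then along
     [v = s *: B]. *)
  exists (s * real_complex R (r * a)); apply/qP; apply: leq_trans rk1.
  have -> : symval (s *: B) - (s * real_complex R (r * a))%:M =
      s *: map_mx (real_complex R) (r *: (symval A2 - a%:M)).
    rewrite symvalZ BA1 A1r symvalZ scalerBr map_mxB scale_scalar_mx map_scalar_mx.
    by rewrite scalerBr scale_scalar_mx.
  apply: leq_trans (mxrankS (scalemx_sub s (submx_refl _))) _.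
  by rewrite mxrank_map mxrankS// scalemx_sub.
- by rewrite pA memv_line.
have /rank_le1_minor minor := (qP A t).1 tP.
have [|w wE] := @minor_sym_square _ _ (symval A - t%:M) _ minor.
  by rewrite linearB /= symval_sym tr_scalar_mx.
by exists A, t, w; split=> //; rewrite -wE addrC subrK.
Qed.

End Closure.

(** * Factoring complex symmetric matrices as [Y *m Y^T] *)

Lemma symmx_anisotropic (K : numDomainType) n (B : 'M[K]_n) : B^T = B -> B != 0 ->
  exists x : 'rV_n, (x *m B *m x^T) 0 0 != 0.
Proof.
move=> Bsym B0; have [//|/forallNP iso] := pselect (exists x : 'rV_n, (x *m B *m x^T) 0 0 != 0).
have {}iso (x : 'rV_n) : (x *m B *m x^T) 0 0 = 0 by have [//|nz] := eqVneq ((x *m B *m x^T) 0 0) 0; case: (iso x nz).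
case/eqP: B0; apply/matrixP => i j; rewrite [RHS]mxE.
have formE i' j' : ((delta_mx 0 i' : 'rV_n) *m B *m (delta_mx 0 j' : 'rV_n)^T) 0 0 = B i' j'.
  by rewrite -rowE trmx_delta -colE !mxE.
have Bji : B j i = B i j by rewrite -[in LHS]Bsym mxE.
(* Polarization: once the diagonal values vanish, this value is [B i j *+ 2]. *)
have := iso (delta_mx 0 i + delta_mx 0 j).
rewrite linearD /= !mulmxDl !mulmxDr [LHS]mxE [X in X + _]mxE [X in _ + X]mxE.
rewrite !formE -[B i i]formE -[B j j]formE !iso add0r addr0 Bji -mulr2n.
by move/eqP; rewrite mulrn_eq0 => /eqP.
Qed.

(* If [x B x^T <> 0], subtracting the square of the normalized column [B x^T]
   lowers the rank. *)
Lemma symmx_square (C : numClosedFieldType) n r (B : 'M[C]_n) : B^T = B ->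
  (\rank B <= r)%N -> exists Y : 'M_(n, r), B = Y *m Y^T.
Proof.
elim: r B => [|r IHr] B Bsym rkB.
  by exists 0; rewrite mul0mx; apply/eqP; rewrite -mxrank_eq0 -leqn0.
have [->|B0] := eqVneq B 0; first by exists 0; rewrite mul0mx.
have [x] := symmx_anisotropic Bsym B0; set c := _ 0 0 => c0.
pose y : 'cV_n := (sqrtC c)^-1 *: (B *m x^T).
have yT : y^T = (sqrtC c)^-1 *: (x *m B).
  by rewrite /y linearZ /= trmx_mul trmxK Bsym.
have yyT : y *m y^T = c^-1 *: (B *m x^T *m (x *m B)).
  by rewrite yT /y -scalemxAl -scalemxAr scalerA -invfM -expr2 sqrtCK.
pose B' := B - y *m y^T.
have B'sym : B'^T = B' by rewrite /B' linearB /= Bsym trmx_mul trmxK.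
have B'x : B' *m x^T = 0.
  have xBx : x *m B *m x^T = c%:M by apply: mx11_scalar.
  rewrite /B' mulmxBl yyT -scalemxAl -[_ *m (x *m B) *m _]mulmxA xBx.
  by rewrite mul_mx_scalar scalerA mulVf// scale1r subrr.
(* The row space shrinks strictly: [B'] kills [x^T], so [B = D *m B'] would force [c = 0]. *)
have B'B : (B' < B)%MS.
  rewrite ltmxE; apply/andP; split.
    rewrite addmx_sub// eqmx_opp yyT scalemx_sub// mulmxA.
    by rewrite submxMl.
  apply/negP => /submxP[D BD]; move: c0.
  by rewrite /c -mulmxA {1}BD -mulmxA B'x !mulmx0 mxE eqxx.
have [Y' B'E] := IHr B' B'sym (leq_trans (rank_ltmx B'B) rkB).
exists (row_mx y Y' : 'M_(n, 1 + r)).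
by rewrite (tr_row_mx y Y') (mul_row_col y Y') -B'E addrC subrK.
Qed.

Lemma symmx_unit_square (C : numClosedFieldType) n (B : 'M[C]_n) : B^T = B ->
  B \in unitmx -> exists2 P : 'M_n, P \in unitmx & B = P *m P^T.
Proof.
move=> Bsym Bu; have [P BP] := symmx_square Bsym (rank_leq_row B).
by exists P => //; move: Bu; rewrite BP unitmx_mul => /andP[].
Qed.

(** * Linear maps, dual bases and bilinear forms in coordinates *)

Lemma linear_homP (K : fieldType) (U V : vectType K) (f : U -> V) :
  (forall a u v, f (a *: u + v) = a *: f u + f v) -> exists g : 'Hom(U, V), g =1 f.
Proof.
move=> f_linear; pose fL := GRing.isLinear.Build _ _ V _ f f_linear.
exists (linfun (HB.pack f fL : {linear U -> V})) => u.
by rewrite lfunE.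
Qed.

Lemma bilform_exists (K : numFieldType) (V : vectType K) (f : V -> V -> K) :
  (forall a u v w, f (a *: u + v) w = a * f u w + f v w) ->
  (forall a u v w, f w (a *: u + v) = a * f w u + f w v) ->
  exists b : bilform V, forall u v, bval b u v = f u v.
Proof.
move=> fl fr.
have /choice[G GE] : forall u, exists g : 'Hom(V, K^o), g =1 f u.
  by move=> u; apply: linear_homP => a v w; rewrite fr.
have [|b bE] := @linear_homP _ V (dual V) (G : V -> dual V).
  by move=> a u v; apply/lfunP => w; rewrite !lfunE /= !lfunE /= !GE fl.
by exists b => u v; rewrite /bval bE GE.
Qed.

Section DualBasis.
Variables (K : fieldType) (W : vectType K) (m : nat) (e : m.-tuple W).
Hypothesis eb : basis_of fullv e.

Lemma dual_basis_exists : exists e' : 'I_m -> dual W,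
  forall i w, (e' i : 'Hom(W, K^o)) w = coord e i w.
Proof.
have /choice[e' e'E] : forall i, exists f : 'Hom(W, K^o), f =1 coord e i.
  by move=> i; apply: (@linear_homP K W K^o) => a u v; rewrite linearP.
by exists e'.
Qed.

Lemma dual_expand (e' : 'I_m -> dual W) (f : dual W) :
  (forall i w, (e' i : 'Hom(W, K^o)) w = coord e i w) ->
  f = \sum_(i < m) ((f : 'Hom(W, K^o)) e`_i : K) *: e' i.
Proof.
move=> e'E; apply/lfunP => w; rewrite sum_lfunE {1}(coord_basis eb (memvf w)).
rewrite linear_sum; apply: eq_bigr => i _.
by rewrite linearZ /= scale_lfunE e'E /= [LHS]mulrC.
Qed.
End DualBasis.

Lemma bvalZl (K : numFieldType) (V : vectType K) (b : bilform V) a u v :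
  bval b (a *: u) v = a * bval b u v.
Proof. by rewrite /bval linearZ /= scale_lfunE. Qed.

Lemma bvalZr (K : numFieldType) (V : vectType K) (b : bilform V) a u v :
  bval b u (a *: v) = a * bval b u v.
Proof. by rewrite /bval linearZ. Qed.

Lemma bvalZ (K : numFieldType) (V : vectType K) (b : bilform V) c u v :
  bval (c *: b) u v = c * bval b u v.
Proof. by rewrite /bval scale_lfunE scale_lfunE. Qed.

Lemma bval_suml (K : numFieldType) (V : vectType K) (b : bilform V) m
    (x : 'I_m -> K) (u : 'I_m -> V) v :
  bval b (\sum_i x i *: u i) v = \sum_i x i * bval b (u i) v.
Proof.
by rewrite /bval linear_sum sum_lfunE; apply: eq_bigr => i _; rewrite linearZ /= scale_lfunE.
Qed.

Lemma bval_sumr (K : numFieldType) (V : vectType K) (b : bilform V) m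
    (x : 'I_m -> K) (u : 'I_m -> V) v :
  bval b v (\sum_i x i *: u i) = \sum_i x i * bval b v (u i).
Proof. by rewrite /bval linear_sum; apply: eq_bigr => i _; rewrite linearZ. Qed.

Lemma quadric_form_mxE (K : comPzRingType) m (B : 'M[K]_m) (x y : 'rV_m) :
  (x *m B *m y^T) 0 0 = \sum_i x 0 i * \sum_j y 0 j * B i j.
Proof.
rewrite -mulmxA mxE; apply: eq_bigr => i _; congr (_ * _).
by rewrite mxE; apply: eq_bigr => j _; rewrite mxE mulrC.
Qed.

Lemma quadric_form_mx_sym (K : comPzRingType) m (B : 'M[K]_m) (x y : 'rV_m) : B^T = B ->
  (x *m B *m y^T) 0 0 = (y *m B *m x^T) 0 0.
Proof.
move=> Bs; have -> : y *m B *m x^T = (x *m B *m y^T)^T.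
  by rewrite !trmx_mul trmxK Bs mulmxA.
by rewrite [RHS]mxE.
Qed.

(** * The quadric through the point configuration as a matrix *)

Section QuadricMatrix.
Variables (C : numFieldType) (W : vectType C) (m : nat) (e : m.-tuple W).
Hypothesis eb : basis_of fullv e.

(** By [dual_expand], these are the coordinates in the basis dual to [e]. *)
Definition dual_coords (f : dual W) : 'rV[C]_m := \row_j ((f : 'Hom(W, C^o)) e`_j : C).

Lemma dual_coords_linear a f g :
  dual_coords (a *: f + g) = a *: dual_coords f + dual_coords g.
Proof. by apply/rowP => j; rewrite !mxE add_lfunE scale_lfunE. Qed.

Lemma bval_mxE (e' : 'I_m -> dual W) (b : bilform (dual W)) f g :
  (forall i w, (e' i : 'Hom(W, C^o)) w = coord e i w) ->
  bval b f g = (dual_coords f *m (\matrix_(i, j) bval b (e' i) (e' j))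
                *m (dual_coords g)^T) 0 0.
Proof.
move=> e'E; rewrite {1}(dual_expand eb f e'E) {1}(dual_expand eb g e'E).
rewrite bval_suml quadric_form_mxE; apply: eq_bigr => i _; rewrite !mxE.
by rewrite bval_sumr; congr (_ * _); apply: eq_bigr => l _; rewrite !mxE.
Qed.

Variables (n : nat) (ell : 'I_n.+1 -> dual W).

(** [B0] is the Gram matrix of the spanning form in the dual basis. Full rank means a trivial
    kernel, and any competing [B] is turned back into a bilinear form vanishing on the
    configuration. *)
Lemma unique_smooth_quadric_mx : on_unique_smooth_quadric (point_config ell) ->
  exists B0 : 'M[C]_m, [/\ B0^T = B0, B0 \in unitmx,
      forall i, (dual_coords (ell i) *m B0 *m (dual_coords (ell i))^T) 0 0 = 0
    & forall B, B^T = B ->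
      (forall i, (dual_coords (ell i) *m B *m (dual_coords (ell i))^T) 0 0 = 0) ->
      exists c, B = c *: B0].
Proof.
move=> [b [bP _ rk_b]]; have [e' e'E] := dual_basis_exists e.
pose mx (b' : bilform (dual W)) : 'M[C]_m := \matrix_(i, j) bval b' (e' i) (e' j).
have mxE' b' f g : bval b' f g = (dual_coords f *m mx b' *m (dual_coords g)^T) 0 0.
  exact: bval_mxE.
have e'e i (j : 'I_m) : (e' i : 'Hom(W, C^o)) e`_j = (i == j)%:R :> C.
  by rewrite e'E coord_free ?(basis_free eb)// eq_sym.
have coords_e' i : dual_coords (e' i) = delta_mx 0 i.
  by apply/rowP => j; rewrite !mxE e'e eq_sym.
have [bsym bZ] : quadrics_through (point_config ell) b by apply/bP; apply: memv_line.
exists (mx b); split.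
- by apply/matrixP => i j; rewrite !mxE bsym.
- rewrite -row_free_unit -kermx_eq0; apply/rowV0P => x /sub_kermxP xb0.
  pose f : dual W := \sum_i x 0 i *: e' i.
  have fx : dual_coords f = x.
    apply/rowP => i; rewrite mxE sum_lfunE (bigD1 i)//= scale_lfunE e'e eqxx big1 ?addr0.
      exact: mulr1.
    by move=> j ji; rewrite scale_lfunE e'e (negPf ji); apply: mulr0.
  have bf0 : b f = 0.
    apply/lfunP => w; rewrite [RHS]lfunE -[LHS]/(bval b f w) mxE' fx xb0 mul0mx.
    by rewrite mxE.
  have ker0 : lker b = 0%VS.
    apply/eqP; rewrite -dimv_eq0; have := limg_ker_dim b fullv.
    by rewrite -/(form_rank b) capfv rk_b => /eqP; rewrite -[X in _ == X]add0n eqn_add2r.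
  have f0 : f = 0 by apply/eqP; rewrite -memv0 -ker0 memv_ker bf0.
  by rewrite -fx f0; apply/rowP => i; rewrite !mxE lfunE.
(* A zero [ell i] gives no point of the configuration, but any form vanishes there. *)
- move=> i; rewrite -mxE'; have [->|li0] := eqVneq (ell i) 0.
    by rewrite /bval linear0.
  apply: (bZ (exist _ <[ell i]>%VS (vline_proj_proof li0))); last exact: memv_line.
  by exists i.
- move=> B Bsym B0.
  have [||b' b'E] := @bilform_exists _ (dual W)
    (fun f g => (dual_coords f *m B *m (dual_coords g)^T) 0 0).
  + by move=> a f g h; rewrite dual_coords_linear !mulmxDl -!scalemxAl !mxE.
  + move=> a f g h; rewrite dual_coords_linear linearD /= linearZ /= mulmxDr -scalemxAr.
    by rewrite !mxE.
  have /bP/vlineP[c cE] : quadrics_through (point_config ell) b'.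
    split=> [f g|p [i ->] _ /vlineP[c ->]]; first by rewrite !b'E quadric_form_mx_sym.
    by rewrite bvalZl bvalZr b'E B0 !mulr0.
  exists c; apply/matrixP => i j; rewrite !mxE -bvalZ -cE b'E !coords_e'.
  by rewrite -rowE trmx_delta -colE !mxE.
Qed.

End QuadricMatrix.

(** Polarization: [D i j] is the square of a sum of two unit rows minus their two squares. *)
Lemma symmx_span (K : numFieldType) m (A : 'M[K]_m) (S : {vspace Sym K m}) : A^T = A ->
  (forall w : 'rV_m, mxsym (w^T *m w) \in S) -> mxsym A \in S.
Proof.
move=> As wS; pose D i j : 'M[K]_m := delta_mx i j + delta_mx j i.
have DE i j : D i j = (delta_mx 0 i + delta_mx 0 j : 'rV[K]_m)^T *m (delta_mx 0 i + delta_mx 0 j)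
   - (delta_mx 0 i : 'rV[K]_m)^T *m delta_mx 0 i - (delta_mx 0 j : 'rV[K]_m)^T *m delta_mx 0 j.
  apply/matrixP => a b; rewrite !mxE !big_ord1 !mxE !eqxx /= -!mulnb !natrM.
  by ring.
(* The factor 1/2 is due to each pair of distinct indices occurring in both orders and to [D i i]
   being twice a matrix unit. *)
have -> : A = \sum_i \sum_j (A i j / 2%:R) *: D i j.
  rewrite {1}(matrix_sum_delta A).
  have -> : \sum_i \sum_j (A i j / 2%:R) *: D i j = \sum_i \sum_j (A i j / 2%:R) *: delta_mx i j
      + \sum_i \sum_j (A i j / 2%:R) *: delta_mx j i.
    rewrite -big_split; apply: eq_bigr => i _; rewrite -big_split; apply: eq_bigr => j _.
    by rewrite scalerDr.
  rewrite [X in _ = _ + X]exchange_big -big_split; apply: eq_bigr => i _ /=.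
  rewrite -big_split; apply: eq_bigr => j _ /=; rewrite -[in A j i]As mxE -scalerDl.
  by congr (_ *: _); field.
rewrite /mxsym linear_sum memv_suml// => i _; rewrite linear_sum memv_suml// => j _.
by rewrite linearZ memvZ// DE !linearB /= !memvB// ?wS.
Qed.

(** * A linear parametrization of the coordinate-wise square *)

Section NormalForm.
Variables (C : numClosedFieldType) (k : nat).
Variables (W : vectType C) (n : nat) (ell : 'I_n.+1 -> dual W).
Hypothesis hW : \dim {:W} = k.+1.
Hypothesis hell : linear_embedding ell.
Hypothesis hZ : on_unique_smooth_quadric (point_config ell).

(** With the quadric written as [P *m P^T], [nu] evaluates the form [P *m A *m P^T] at every
    [ell i]. By uniqueness it kills only the multiples of the quadric, that is, the scalar matrices
    [A]. *)
Lemma square_param : exists nu : 'Hom(Sym C k.+1, 'rV[C]_n.+1),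
  [/\ forall A, nu A = 0 <-> exists c, symval A = c%:M,
    forall q, csquare (embedded_space ell) q ->
      exists w : 'rV_k.+1, val q = <[nu (mxsym (w^T *m w))]>%VS
  & forall w : 'rV_k.+1, w != 0 -> exists2 q, csquare (embedded_space ell) q &
      val q = <[nu (mxsym (w^T *m w))]>%VS].
Proof.
have [e eb] : exists e : k.+1.-tuple W, basis_of fullv e.
  by rewrite -hW; exists (vbasis fullv); apply: vbasisP.
have [B0 [B0sym B0u rB0 B0uniq]] := unique_smooth_quadric_mx eb hZ.
have [P Pu B0E] := symmx_unit_square B0sym B0u.
pose a i : 'rV[C]_k.+1 := dual_coords e (ell i).
pose quad (A : 'M[C]_k.+1) i := (a i *m (P *m A *m P^T) *m (a i)^T) 0 0.
have quadP c A B i : quad (c *: A + B) i = c * quad A i + quad B i.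
  by rewrite /quad !(mulmxDl, mulmxDr) -!(scalemxAr, scalemxAl) mxE [X in X + _]mxE.
have [nu nuE] : exists nu : 'Hom(Sym C k.+1, 'rV[C]_n.+1), forall A,
    nu A = \row_i quad (symval A) i.
  have [|nu nuE] := @linear_homP C (Sym C k.+1) 'rV[C]_n.+1
    (fun A : Sym C k.+1 => \row_i quad (symval A) i); last by exists nu.
  by move=> c A B; apply/rowP => i; rewrite !mxE symvalP quadP.
(* Twisting the basis by [P] makes [ell i (vec w)] the linear form in [w] whose square is the [i]-th
   coordinate of [nu] at [w^T *m w]. *)
pose vec (w : 'rV[C]_k.+1) : W := \sum_j (w *m P^T) 0 j *: e`_j.
have ellE i w : (ell i : 'Hom(W, C^o)) (vec w) = (w *m P^T *m (a i)^T) 0 0 :> C.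
  rewrite mxE linear_sum; apply: eq_bigr => j _.
  by rewrite linearZ !mxE.
have squareE w : nu (mxsym (w^T *m w)) =
    map_mx (fun x => x ^+ 2) (\row_i ((ell i : 'Hom(W, C^o)) (vec w) : C)).
  apply/rowP => i; rewrite nuE [RHS]mxE [in RHS]mxE [LHS]mxE ellE.
  rewrite mxsymK ?trmx_mul ?trmxK// /quad.
  have -> : a i *m (P *m (w^T *m w) *m P^T) *m (a i)^T =
      (w *m P^T *m (a i)^T)^T *m (w *m P^T *m (a i)^T).
    by rewrite !trmx_mul !trmxK !mulmxA.
  by rewrite mxE big_ord1 [X in X * _]mxE expr2.
have vec_surj v : exists w, v = vec w.
  exists ((\row_j coord e j v) *m invmx P^T).
  rewrite /vec mulmxKV ?unitmx_tr// {1}(coord_basis eb (memvf v)).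
  by apply: eq_bigr => j _; rewrite mxE.
have vec_inj w : vec w = 0 -> w = 0.
  move=> w0; have wP0 : w *m P^T = 0.
    apply/rowP => j.
    by have /freeP/(_ _ w0 j) -> := basis_free eb; rewrite mxE.
  by rewrite -[w](mulmxK (_ : P^T \in unitmx)) ?unitmx_tr// wP0 mul0mx.
exists nu; split.
- move=> A; rewrite nuE; split=> [/rowP A0|[c ->]]; last first.
    apply/rowP => i; rewrite mxE [RHS]mxE /quad mul_mx_scalar -scalemxAl -B0E.
    by rewrite -scalemxAr -scalemxAl mxE rB0 mulr0.
  have [||c cE] := B0uniq (P *m symval A *m P^T).
  + by rewrite !trmx_mul trmxK symval_sym mulmxA.
  + by move=> i; have := A0 i; rewrite mxE [RHS]mxE.
  exists c; rewrite -[symval A](mulKmx Pu).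
  rewrite -[P *m symval A](mulmxK (_ : P^T \in unitmx)) ?unitmx_tr// cE B0E.
  by rewrite -scalemxAl mulmxK ?unitmx_tr// -scalemxAr mulVmx// scalemx1.
- move=> q [p [v [[w pw] pv ->]]].
  have /vlineP[c vE] : v \in <[\row_i ((ell i : 'Hom(W, C^o)) w : C)]>%VS.
    by rewrite -pw pv memv_line.
  have [x xE] := vec_surj (c *: w); exists x; rewrite squareE -xE; congr (<[map_mx _ _]>%VS).
  by rewrite vE; apply/rowP => i; rewrite !mxE linearZ.
(* Injectivity of [vec] and [hell] make [r] nonzero, and squaring its coordinates keeps it so. *)
- move=> w w0; pose r := \row_i ((ell i : 'Hom(W, C^o)) (vec w) : C).
  have r0 : r != 0.
    apply: contraNneq w0 => /rowP r0; apply/eqP/vec_inj/hell => i.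
    by have := r0 i; rewrite !mxE.
  have s0 : nu (mxsym (w^T *m w)) != 0.
    apply: contraNneq r0; rewrite squareE => /rowP r0; apply/eqP/rowP => i.
    by have /eqP := r0 i; rewrite !mxE sqrf_eq0 => /eqP.
  exists (exist _ <[nu (mxsym (w^T *m w))]>%VS (vline_proj_proof s0)) => //.
  exists (exist _ <[r]>%VS (vline_proj_proof r0)), r; split=> //=; first by exists (vec w).
  by rewrite squareE.
Qed.
End NormalForm.

(** The squares [w^T *m w] span the symmetric matrices, so their images span the image of [nu]. *)
Lemma linspan_square_param (K : numFieldType) (m n : nat) (nu : 'Hom(Sym K m, 'rV[K]_n))
    (Y : set (proj 'rV[K]_n)) :
  (forall q, Y q -> exists w : 'rV_m, val q = <[nu (mxsym (w^T *m w))]>%VS) ->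
  (forall w : 'rV_m, w != 0 ->
     exists2 q, Y q & val q = <[nu (mxsym (w^T *m w))]>%VS) ->
  linspan Y = limg nu.
Proof.
move=> Yw wY; have [YS Smin] := linspanP Y; apply/eqP; rewrite eqEsubv; apply/andP; split.
  apply: Smin => p /Yw[w ->].
  by rewrite -memvE memv_img ?memvf.
apply/subvP => _ /memv_imgP[A _ ->]; rewrite -[A]symvalK.
suff : mxsym (symval A) \in (nu @^-1: linspan Y)%VS by rewrite memv_preim.
apply: symmx_span => [|w]; first exact: symval_sym.
rewrite -memv_preim; have [->|/wY[q Yq qE]] := eqVneq w 0.
  by rewrite mulmx0 /mxsym !linear0 mem0v.
by rewrite memvE -qE YS.
Qed.

(** * The isomorphism carrying the closure to the cone *)

Theorem proposition4p3 (R : realType) (k : nat) (hk : (1 <= k)%N)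
    (W : vectType R[i]) (hW : \dim {:W} = k.+1)
    (n : nat) (ell : 'I_n.+1 -> dual W)
    (hell : linear_embedding ell)
    (hZ : on_unique_smooth_quadric (point_config ell)) :
  proj_equiv (zclosure (complexify (mult_eigen_locus R k)))
             (pcone (in_linspan (csquare (embedded_space ell)))).
Proof.
set Y := csquare _; have [nu [nu_ker Yw wY]] := square_param hW hell hZ.
have limg_nu := linspan_square_param Yw wY.
set S := linspan Y in limg_nu *.
pose scalar c : Sym R[i] k.+1 := mxsym c%:M.
have scalarE c : symval (scalar c) = c%:M by rewrite mxsymK ?tr_scalar_mx.
have nu_scalar c : nu (scalar c) = 0 by apply/nu_ker; exists c.
have [f fE] : exists f : 'Hom(Sym R[i] k.+1, (subvs_of S * R[i]^o)%type),
    forall A, f A = (vsproj S (nu A), \tr (symval A)).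
  have [|f fE] := @linear_homP _ (Sym R[i] k.+1) (subvs_of S * R[i]^o)%type
     (fun A : Sym R[i] k.+1 => (vsproj S (nu A), \tr (symval A))); last by exists f.
  by move=> c A B; rewrite symvalP !linearP.
have nuS A : nu A \in S by rewrite limg_nu memv_img ?memvf.
have tr_scalar c : \tr (symval (scalar c)) = k.+1%:R * c.
  by rewrite scalarE mxtrace_scalar mulr_natl.
have k0 : k.+1%:R != 0 :> R[i] by rewrite pnatr_eq0.
(* Adding a scalar matrix fixes [nu] and moves the trace to any prescribed value, since [k.+1] is
   invertible. *)
have f_onto (v : subvs_of S) (t : R[i]) A : nu A = vsval v ->
    exists c, f (A + scalar c) = (v, t).
  move=> Av; exists ((t - \tr (symval A)) / k.+1%:R); rewrite fE symvalD mxtraceD.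
  rewrite tr_scalar [nu _]linearD /= nu_scalar addr0 Av vsvalK.
  by rewrite mulrC divfK// addrC subrK.
exists f; split.
- apply/eqP; rewrite -subv0; apply/subvP => A; rewrite memv_ker fE memv0.
  case/eqP => nuA trA; have /nu_ker[c Ac] : nu A = 0.
    by rewrite -[LHS](vsprojK (nuS A)) nuA linear0.
  move: trA; rewrite Ac mxtrace_scalar -mulr_natl => /eqP.
  rewrite mulf_eq0 (negPf k0) /= => /eqP c0.
  by rewrite -[A]symvalK Ac c0 raddf0 /mxsym linear0.
- apply/eqP; rewrite eqEsubv subvf /=; apply/subvP => -[v t] _.
  have /memv_imgP[A _ vA] : vsval v \in limg nu by rewrite -limg_nu subvsP.
  have [c <-] := f_onto v t A (esym vA).
  by rewrite memv_img ?memvf.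
apply/seteqP; split => q /=.
- move=> [p [v [t [[q' [v' [Yq' pv' q'v']]] vp qE]]]].
  have [w q'w] := Yw _ Yq'.
  have /vlineP[r vr] : vsval v \in <[nu (mxsym (w^T *m w))]>%VS.
    rewrite -q'w q'v'; move: vp; rewrite pv' => /vlineP[s ->].
    by rewrite linearZ memvZ ?memv_line.
  (* The height [t] over the base of the cone is reached by the scalar part [c]. *)
  have [|c fA] := f_onto v t (r *: mxsym (w^T *m w)); first by rewrite linearZ vr.
  set A := _ + _ in fA.
  have A0 : A != 0.
    have qdim : \dim (val q) == 1%N by exact: (svalP q).
    by apply: contraTneq qdim => A0; rewrite qE -fA A0 linear0 dim_vline eqxx.
  exists (exist _ <[A]>%VS (vline_proj_proof A0)); last by rewrite /= limg_line fA.
  apply/(zclosure_locus hk); exists A, c, (sqrtC r *: w); split=> //.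
  rewrite symvalD symvalZ scalarE addrC.
  rewrite mxsymK ?trmx_mul ?trmxK//; congr (_ + _).
  by apply/matrixP => i j; rewrite !mxE !big_ord1 !mxE mulrACA -expr2 sqrtCK.
- move=> [p /(zclosure_locus hk)[A [a [w [pA AE]]]] qE].
  rewrite pA limg_line fE in qE.
  have nuA : nu A = nu (mxsym (w^T *m w)).
    by rewrite -[A]symvalK AE /mxsym linearD linearD /= -/(scalar a) nu_scalar add0r.
  (* When [w = 0] the image is the vertex, which lies on the line to any point of [Y]; the one given
     by the first unit row is chosen. *)
  have [w1 w10 wE] : exists2 w1 : 'rV[R[i]]_k.+1, w1 != 0
      & nu A \in <[nu (mxsym (w1^T *m w1))]>%VS.
    have [w0|w0] := eqVneq w 0; last by exists w => //; rewrite nuA memv_line.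
    exists (delta_mx 0 0); last by rewrite nuA w0 mulmx0 /mxsym !linear0 mem0v.
    by apply/eqP => /rowP/(_ 0)/eqP; rewrite !mxE !eqxx oner_eq0.
  have [q' Yq' q'w] := wY w1 w10.
  set x := nu (mxsym (w1^T *m w1)) in wE q'w.
  have xS : vsval (vsproj S x) = x by rewrite vsprojK ?nuS.
  have x0 : vsproj S x != 0.
    have q'dim : \dim (val q') == 1%N by exact: (svalP q').
    by apply: contraTneq q'dim => x0; rewrite q'w -xS x0 linear0 dim_vline eqxx.
  exists (exist _ <[vsproj S x]>%VS (vline_proj_proof x0)), (vsproj S (nu A)), (\tr (symval A)).
  split=> //=; last first.
    by have /vlineP[s ->] := wE; rewrite linearZ memvZ ?memv_line.
  by exists q', (vsproj S x); split=> //; rewrite q'w xS.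
Qed.
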